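(* Let $F$ be an Archimedean vector lattice. The following conditions are equivalent: (i) $F$ is Dedekind complete and atomic; (ii) every order interval in $F$ is order compact; (iii) $F$ is order locally compact.
   Context: For $p\le q$ in a lattice $P$ the order interval is $[p,q]=\{r\in P : p\le r\le q\}$. A vector lattice $F$ is Dedekind complete if its order intervals are complete lattices. An element $f>0$ of $F$ is an atom if $[0,f]$ consists of scalar multiples of $f$; $F$ is atomic if for every $g>0$ the interval $[0,g]$ contains an atom. A filter on a set $\Omega$ is a (proper, nonempty) filter of subsets of $\Omega$; an ultrafilter is a maximal such filter. A filter $\mathcal{F}$ on a lattice $P$ order converges to $p\in P$ if $\mathcal{F}$ contains a collection of order intervals of $P$ whose intersection is $\{p\}$. Equivalently, in terms of nets: $(p_\alpha)$ order converges to $p$ if there are an increasing net $(q_\beta)_{\beta\in B}$ and a decreasing net $(r_\beta)_{\beta\in B}$ in $P$ with $\bigvee_\beta q_\beta=p=\bigwedge_\beta r_\beta$ such that for every $\beta$ there is $\alpha_0$ with $q_\beta\le p_\alpha\le r_\beta$ for all $\alpha\ge\alpha_0$. (Order convergence in an order interval of $F$, regarded as a lattice, agrees with order convergence in $F$.) A subset $S\subseteq P$ is order compact if every ultrafilter on $P$ that contains $S$ order converges to an element of $S$ (equivalently, every net in $S$ has a subnet that order converges to an element of $S$). $P$ is order locally compact if every order convergent filter on $P$ contains an order compact set. *)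

(* Defs.v *)
From HB Require Import structures.
From mathcomp Require Import all_boot all_order all_algebra.
From mathcomp Require Import all_classical all_reals.

Set Implicit Arguments.
Unset Strict Implicit.
Unset Printing Implicit Defensive.

Import Order.TTheory GRing.Theory Num.Theory.

Local Open Scope classical_set_scope.
Local Open Scope ring_scope.

(* [Order.Lattice] and [GRing.Lmodule] cannot be joined: the hierarchy already
   infers [realDomainType] for a type that is both a lattice and an additive
   group. So the lattice operations are given here over [Order.POrder], by the
   axioms of [Order.POrder_isMeetSemilattice] and
   [Order.POrder_isJoinSemilattice]. *)
HB.mixin Record Lmodule_POrder_isVectorLattice (R : realType) F
    of GRing.Lmodule R F & Order.POrder ring_display F := {
  vmeet : F -> F -> F ;
  vjoin : F -> F -> F ;
  vlexI : forall f g h : F, (f <= vmeet g h) = (f <= g) && (f <= h) ;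
  vleUx : forall f g h : F, (vjoin f g <= h) = (f <= h) && (g <= h) ;
  vleD2r : forall h f g : F, f <= g -> f + h <= g + h ;
  vscale_ge0 : forall (c : R) (f : F), 0 <= c -> 0 <= f -> 0 <= c *: f
}.

#[short(type="vectorLatticeType")]
HB.structure Definition VectorLattice (R : realType) :=
  { F of GRing.Lmodule R F & Order.POrder ring_display F
       & Lmodule_POrder_isVectorLattice R F }.

(* These notions depend only on the order relation, so they are stated for a
   [porderType]; a [vectorLatticeType] is one, but is not a [latticeType]. *)
Section OrderConvergence.
Context {d : Order.disp_t} {P : porderType d}.
Local Open Scope order_scope.

Definition order_interval : set (set P) :=
  [set I | exists p q : P, p <= q /\ I = `[p, q]%classic].

(* Suprema and infima are those of [I] as a lattice on its own. Taking [A]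
   empty is allowed, so a complete lattice has a least and a greatest
   element. *)
Definition complete_lattice (I : set P) : Prop :=
  forall A : set P, A `<=` I ->
    (I `&` ubound A `&` lbound (I `&` ubound A)) !=set0 /\
    (I `&` lbound A `&` ubound (I `&` lbound A)) !=set0.

Definition order_converges (U : set_system P) (p : P) : Prop :=
  exists J : set (set P),
    [/\ J `<=` order_interval, J `<=` U & \bigcap_(I in J) I = [set p]].

Definition order_compact (S : set P) : Prop :=
  forall U : set_system P, UltraFilter U -> U S ->
    exists2 p : P, S p & order_converges U p.

End OrderConvergence.

Definition order_locally_compact {d : Order.disp_t} (P : porderType d) : Prop :=
  forall U : set_system P, ProperFilter U ->
    (exists p : P, order_converges U p) ->
    exists2 S : set P, U S & order_compact S.

Definition dedekind_complete {d : Order.disp_t} (P : porderType d) : Prop :=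
  forall I : set P, order_interval I -> complete_lattice I.

Section VectorLatticeNotions.
Context {R : realType} (F : vectorLatticeType R).

Definition archimedean : Prop :=
  forall f g : F, (forall n : nat, f *+ n <= g) -> f <= 0.

Definition atom (f : F) : Prop :=
  0 < f /\ forall g : F, 0 <= g <= f -> exists c : R, g = c *: f.

Definition atomic : Prop :=
  forall g : F, 0 < g -> exists2 f : F, 0 <= f <= g & atom f.

End VectorLatticeNotions.

(* Main.v *)
(* (i) => (ii): for an atom [e] of an Archimedean space and [c *: e <= h], every
   [g] in [0, h] satisfies [l *: e <= g] or [g <= h - (c - l) *: e]. An
   ultrafilter on [p, q] therefore contains one of two intervals, so no atom
   fits below the gap between the supremum of its lower bounds and the infimum
   of its upper bounds.
   (iii) => (i): the intervals [0, h / n] converge to 0, so one of them lies in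
   an order compact set; by an affine change of variables every interval is
   order compact. Limits of ultrafilters on directed sets give completeness. If
   no atom lies below [g > 0], then for finitely many [0 < p <= g] there is an
   [x] in [0, g] with [p] below neither [x] nor [g - x]: refine the [p]'s to
   pairwise disjoint [r]'s and [s]'s, two for each [p], and take the meet of
   [g] with a large multiple of the sum of the [s]'s. An ultrafilter containing
   the sets of all such [x] lies in no order interval other than those
   containing [0, g], so it does not converge. *)
Require Import Defs.
From mathcomp Require Import all_boot all_order all_algebra.
From mathcomp Require Import all_classical all_reals.
From mathcomp Require Import lra.

Set Implicit Arguments.
Unset Strict Implicit.
Unset Printing Implicit Defensive.

Import Order.TTheory GRing.Theory Num.Theory.

Local Open Scope classical_set_scope.
Local Open Scope ring_scope.

(** * Order compactness under order automorphisms *)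

(** The ultrafilter is pushed forward along [phi], and the intervals that witness convergence there
    are pulled back. This allows intervals to be translated and rescaled. *)
Lemma order_compact_preimage (d : Order.disp_t) (P : porderType d)
    (phi psi : P -> P) (S : set P) :
  cancel phi psi -> cancel psi phi -> {mono phi : x y / (x <= y)%O} ->
  order_compact S -> order_compact (phi @^-1` S).
Proof.
move=> phiK psiK phi_mono cptS U ultraU US.
have phi_surj : phi @` setT = setT.
  by apply/seteqP; split=> // y _; exists (psi y); rewrite ?psiK.
have phi_inj := can_inj phiK.
have imS : phi @` (phi @^-1` S) = S by rewrite image_preimage.
have [|y Sy [J [Jitv JU Jy]]] := cptS _ (ultra_image ultraU phi_surj).
  by exists (phi @^-1` S).
exists (psi y); first by rewrite /= psiK.
exists [set phi @^-1` K | K in J]; split.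
- move=> _ [K JK <-]; have [a [b [ab ->]]] := Jitv _ JK.
  exists (psi a), (psi b); split; first by rewrite -phi_mono !psiK.
  apply/seteqP; split=> x /=;
    by rewrite !in_itv /= -[(psi a <= x)%O]phi_mono -[(x <= psi b)%O]phi_mono
      !psiK.
- move=> _ [K JK <-]; have [A UA <-] := JU _ JK.
  suff -> : phi @^-1` (phi @` A) = A by [].
  by apply/seteqP; split=> [x [z Az /phi_inj <-]|x Ax] //; exists x.
- apply/seteqP; split=> [x xJ|x ->].
    have : (\bigcap_(K in J) K) (phi x).
      by move=> K JK; apply: (xJ (phi @^-1` K)); exists K.
    by rewrite Jy => <-; rewrite phiK.
  move=> _ [K JK <-] /=; rewrite psiK.
  by have /(_ K JK) : (\bigcap_(K in J) K) y by rewrite Jy.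
Qed.

Section VectorLatticeTheory.
Context {R : realType} {F : vectorLatticeType R}.
Implicit Types (a b e f g h p q u v x : F) (c l : R).

(** * Arithmetic of the order *)

Lemma vleD2 h f g : (f + h <= g + h) = (f <= g).
Proof.
apply/idP/idP => [fg|]; last exact: vleD2r.
by rewrite -[f](addrK h) -[g](addrK h); exact: vleD2r.
Qed.

Lemma vsubr_ge0 f g : (0 <= g - f) = (f <= g).
Proof. by rewrite -(vleD2 f 0) add0r subrK. Qed.

Lemma vsubr_gt0 f g : (0 < g - f) = (f < g).
Proof. by rewrite !lt_neqAle vsubr_ge0 [0 == _]eq_sym subr_eq0 eq_sym. Qed.

Lemma vlerBlDr f g h : (f - h <= g) = (f <= g + h).
Proof. by rewrite -(vleD2 h (f - h)) subrK. Qed.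

Lemma vlerBrDr f g h : (f <= g - h) = (f + h <= g).
Proof. by rewrite -(vleD2 h f) subrK. Qed.

Lemma vleD f g h k : f <= g -> h <= k -> f + h <= g + k.
Proof.
move=> fg hk; apply: (@le_trans _ _ (g + h)); first exact: vleD2r.
by rewrite ![g + _]addrC vleD2.
Qed.

Lemma vaddr_ge0 f g : 0 <= f -> 0 <= g -> 0 <= f + g.
Proof. by move=> f0 g0; rewrite -[0]addr0 vleD. Qed.

Lemma vgerBl f g : 0 <= g -> f - g <= f.
Proof. by move=> g0; rewrite vlerBlDr -{1}[f]addr0 vleD. Qed.

Lemma vler_wpZ2l c f g : 0 <= c -> f <= g -> c *: f <= c *: g.
Proof.
by move=> c0 fg; rewrite -vsubr_ge0 -scalerBr vscale_ge0 ?vsubr_ge0.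
Qed.

Lemma vler_wpZ2r e c l : 0 <= e -> c <= l -> c *: e <= l *: e.
Proof.
by move=> e0 cl; rewrite -vsubr_ge0 -scalerBl vscale_ge0 ?subr_ge0.
Qed.

Lemma vler_pZ2l c f g : 0 < c -> (c *: f <= c *: g) = (f <= g).
Proof.
move=> c0; apply/idP/idP => [|fg]; last by rewrite vler_wpZ2l // ltW.
have ci0 : 0 <= c^-1 by rewrite invr_ge0 ltW.
by move=> /(vler_wpZ2l ci0); rewrite !scalerA mulVf ?gt_eqF// !scale1r.
Qed.

Lemma vsumr_ge0 n (s : nat -> F) :
  (forall i, (i < n)%N -> 0 <= s i) -> 0 <= \sum_(i < n) s i.
Proof.
move=> s0; elim/big_ind: _ => //; first exact: vaddr_ge0.
by move=> i _; exact: s0.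
Qed.

Lemma vler_sum n (s : nat -> F) (k : nat) : (k < n)%N ->
  (forall i, (i < n)%N -> 0 <= s i) -> s k <= \sum_(i < n) s i.
Proof.
move=> kn s0; rewrite (bigD1 (Ordinal kn)) //= -{1}[s k]addr0 vleD //.
elim/big_ind: _ => //; first exact: vaddr_ge0.
by move=> i _; exact: s0.
Qed.

(** * Meets, joins and disjointness, the latter in the form [vmeet f g <= 0] *)

Lemma vleIl f g : vmeet f g <= f.
Proof. by have := lexx (vmeet f g); rewrite vlexI => /andP[]. Qed.

Lemma vleIr f g : vmeet f g <= g.
Proof. by have := lexx (vmeet f g); rewrite vlexI => /andP[]. Qed.

Lemma vleUl f g : f <= vjoin f g.
Proof. by have := lexx (vjoin f g); rewrite vleUx => /andP[]. Qed.

Lemma vleUr f g : g <= vjoin f g.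
Proof. by have := lexx (vjoin f g); rewrite vleUx => /andP[]. Qed.

Lemma vmeetC f g : vmeet f g = vmeet g f.
Proof. by apply/le_anti; rewrite !vlexI !vleIl !vleIr. Qed.

Lemma vmeet_le0S a b f g : f <= a -> g <= b -> vmeet a b <= 0 ->
  vmeet f g <= 0.
Proof.
move=> fa gb; apply: le_trans; rewrite vlexI.
by rewrite (le_trans (vleIl _ _) fa) (le_trans (vleIr _ _) gb).
Qed.

(** With [w] the meet on the left, [w - b] lies below both [r] and [a], so [w <= b]; then [w] lies
    below both [r] and [b]. *)
Lemma vmeet_le0D r a b : 0 <= b -> vmeet r a <= 0 -> vmeet r b <= 0 ->
  vmeet r (a + b) <= 0.
Proof.
move=> b0 ra rb; set w := vmeet r (a + b).
suff wb : w <= b by apply: le_trans rb; rewrite vlexI vleIl.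
suff : w - b <= 0 by rewrite vlerBlDr add0r.
apply: le_trans ra; rewrite vlexI (le_trans (vgerBl _ b0)) ?vleIl//=.
by rewrite vlerBlDr vleIr.
Qed.

Lemma vmeet_le0_sum r n (s : nat -> F) :
  (forall i, (i < n)%N -> 0 <= s i /\ vmeet r (s i) <= 0) ->
  vmeet r (\sum_(i < n) s i) <= 0.
Proof.
move=> rs.
suff [] : 0 <= \sum_(i < n) s i /\ vmeet r (\sum_(i < n) s i) <= 0 by [].
elim/big_ind: _ => [|f g [f0 rf] [g0 rg]|i _]; last exact: rs.
- by split=> //; exact: vleIr.
- by split; [exact: vaddr_ge0|exact: vmeet_le0D].
Qed.

Lemma vmeet_le0_mulrn (r s : F) n : 0 <= s -> vmeet r s <= 0 ->
  vmeet r (s *+ n) <= 0.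
Proof.
move=> s0 rs; elim: n => [|n IHn]; first exact: vleIr.
by rewrite mulrSr vmeet_le0D.
Qed.

Lemma vmeet_subI_le0 f g :
  vmeet (f - vmeet f g) (g - vmeet f g) <= 0.
Proof.
rewrite -(vleD2 (vmeet f g)) add0r vlexI.
by rewrite -!vlerBrDr vleIl vleIr.
Qed.

(** * Limits in intervals, and completeness from compactness *)

(** Every interval of [J] meets [[a, b]], both being in [U]. Hence it contains [vjoin p a] and
    [vmeet p b] along with [p], and these must equal [p]. *)
Lemma order_converges_itv (U : set_system F) p a b : ProperFilter U ->
  order_converges U p -> U `[a, b]%classic -> a <= p <= b.
Proof.
move=> UF [J [Jitv JU Jp]] Uab.
have JE K : J K -> exists y z,
    [/\ K = `[y, z]%classic, y <= p <= z, y <= b & a <= z].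
  move=> JK; have [y [z [_ KE]]] := Jitv _ JK; exists y, z.
  have [x []] := filter_ex (filterI (JU _ JK) Uab).
  have Kp : K p by have /(_ K JK) : (\bigcap_(I in J) I) p by rewrite Jp.
  move: Kp; rewrite KE /= !in_itv /= => pyz /andP[yx xz] /andP[ax xb].
  by split=> //; [exact: le_trans xb|exact: le_trans xz].
apply/andP; split.
  suff : (\bigcap_(I in J) I) (vjoin p a).
    by rewrite Jp => /= <-; exact: vleUr.
  move=> _ /JE[y [z [-> /andP[yp pz] yb az]]] /=.
  by rewrite in_itv /= (le_trans yp (vleUl _ _)) vleUx pz.
suff : (\bigcap_(I in J) I) (vmeet p b).
  by rewrite Jp => /= <-; exact: vleIr.
move=> _ /JE[y [z [-> /andP[yp pz] yb az]]] /=.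
by rewrite in_itv /= (le_trans (vleIl _ _) pz) vlexI yp yb.
Qed.

Lemma order_compact_subitv (S : set F) a b : order_compact S ->
  `[a, b]%classic `<=` S -> order_compact `[a, b]%classic.
Proof.
move=> cptS abS U ultraU Uab.
have [p _ Up] := cptS U ultraU (filterS abS Uab).
by exists p => //=; rewrite in_itv /=; exact: order_converges_itv Uab.
Qed.

Lemma order_compact_itv_complete_lattice p q : p <= q ->
  order_compact `[p, q]%classic -> complete_lattice `[p, q]%classic.
Proof.
move=> pq cptI.
have hassup (A : set F) : A `<=` `[p, q]%classic -> exists x,
    [/\ p <= x <= q, ubound A x &
        forall v, p <= v <= q -> ubound A v -> x <= v].
  move=> AI.
  (* [B] is directed and nonempty even when [A] is not. *)
  pose B := [set b | p <= b <= q /\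
    forall v, p <= v <= q -> ubound A v -> b <= v].
  have Bp : B p by split; [rewrite lexx|move=> v /andP[]].
  have Bjoin : forall b b', B b -> B b' -> B (vjoin b b').
    move=> b b' [/andP[pb bq] bv] [/andP[pb' b'q] b'v]; split.
      by rewrite (le_trans pb (vleUl _ _)) vleUx bq.
    by move=> v vI vA; rewrite vleUx bv // b'v.
  (* The tails of [B] form a filter base; the limit of an ultrafilter refining it is the supremum of
     [A]. *)
  pose G := filter_from B (fun b => B `&` [set x | b <= x]).
  have GP : ProperFilter G.
    apply: filter_from_proper; last by move=> b Bb; exists b; split=> /=.
    apply: filter_from_filter; first by exists p.
    move=> b b' Bb Bb'; exists (vjoin b b'); first exact: Bjoin.
    move=> x [Bx /= bx]; split; split=> //=; apply: le_trans bx.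
      exact: vleUl.
    exact: vleUr.
  have [U [ultraU GU]] := ultraFilterLemma GP.
  have UBge b : B b -> U (B `&` [set x | b <= x]).
    by move=> Bb; apply: GU; exists b.
  have [|x /=] := cptI U ultraU.
    apply: filterS (UBge p Bp) => x [[xI _] _] /=; by rewrite in_itv.
  rewrite in_itv /= => xI Ux; exists x; split=> // [a Aa|v vI vA].
    have aI : p <= a <= q by have := AI _ Aa; rewrite /= in_itv.
    have Ba : B a by split=> // v _; apply.
    suff /(order_converges_itv _ Ux)/andP[] : U `[a, q]%classic by [].
    apply: filterS (UBge a Ba) => y [[/andP[_ yq] _] /= ay].
    by rewrite in_itv /= ay yq.
  suff /(order_converges_itv _ Ux)/andP[] : U `[p, v]%classic by [].
  apply: filterS (UBge p Bp) => y [[/andP[py _] yv] _].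
  by rewrite /= in_itv /= py yv.
move=> A AI; split.
  have [x [xI xA xle]] := hassup A AI.
  exists x; split; first by split=> //=; rewrite in_itv.
  by move=> v [vI vA]; apply: xle => //; move: vI; rewrite /= in_itv.
(* The infimum of [A] is the supremum of its lower bounds in the interval. *)
have [|x [xI xA xle]] := hassup (`[p, q]%classic `&` lbound A).
  by move=> y [].
exists x; split; last by [].
split; first by rewrite /= in_itv.
move=> a Aa; apply: xle; first by have := AI _ Aa; rewrite /= in_itv.
by move=> y [_]; apply.
Qed.

(** * Atoms, and compactness of intervals in the atomic case *)

Hypothesis archF : archimedean F.

(** The Archimedean property is used twice: it bounds the set of coefficients, and it shows that the
    supremum is attained. *)
Lemma maximal_coefficient e f : 0 < e -> 0 <= f ->
  exists c, [/\ 0 <= c, c *: e <= f & forall l, l *: e <= f -> l <= c].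
Proof.
move=> e0 f0; have e0' := ltW e0.
pose A := [set c | c *: e <= f].
have A0 : A 0 by rewrite /A /= scale0r.
have supA : has_sup A.
  split; first by exists 0.
  apply: contrapT => unb; have : e <= 0; last by rewrite lt_geF.
  apply: (archF (g := f)) => n.
  have [c Ac nc] : exists2 c, A c & n%:R < c.
    apply: contrapT => nex; apply: unb; exists n%:R => c Ac.
    by rewrite leNgt; apply/negP => nc; apply: nex; exists c.
  by rewrite -scaler_nat (le_trans _ Ac)// vler_wpZ2r// ltW.
have supP l : l *: e <= f -> l <= sup A by move=> Al; apply: (ub_le_sup supA.2).
exists (sup A); split=> //; first exact: supP.
rewrite -[f]add0r -vlerBlDr; apply: (archF (g := e)) => -[|n]//.
have n0 : 0 < n.+1%:R^-1 :> R by rewrite invr_gt0.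
have [c Ac sc] := sup_adherent n0 supA.
rewrite -scaler_nat -(vler_pZ2l _ _ n0) scalerA mulVf ?pnatr_eq0// scale1r.
rewrite vlerBlDr addrC -vlerBlDr (le_trans _ Ac)// -scalerBl.
by rewrite vler_wpZ2r// ltW.
Qed.


(** Let [k] be the largest coefficient of [e] below [g]. If [k < l], then [g - k *: e] is disjoint
    from [e], hence below [h - c *: e], and [g <= h - (c - k) *: e]. *)
Lemma atom_split e g h c l : atom e -> 0 <= g <= h -> c *: e <= h ->
  0 <= l <= c -> l *: e <= g \/ g <= h - (c - l) *: e.
Proof.
move=> [e0 eP] /andP[g0 gh] ceh /andP[l0 lc]; have e0' := ltW e0.
have [k [k0 keg kmax]] := maximal_coefficient e0 g0.
have [lk|kl] := leP l k; first by left; rewrite (le_trans _ keg)// vler_wpZ2r.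
right; have c0 : 0 < c by exact: le_lt_trans (lt_le_trans kl lc).
(* The part of [g] disjoint from [e] lies below [h - c *: e]. *)
have gk0 : 0 <= g - k *: e by rewrite vsubr_ge0.
set m := vmeet (g - k *: e) (c *: e).
have m0 : 0 <= m by rewrite vlexI gk0 vscale_ge0// ltW.
have [d md] : exists d, m = d *: e.
  have [|d dE] := eP (c^-1 *: m).
    apply/andP; split; first by rewrite vscale_ge0// invr_ge0 ltW.
    by rewrite -(vler_pZ2l _ _ c0) scalerA divff ?gt_eqF// scale1r vleIr.
  by exists (c * d); rewrite -scalerA -dE scalerA divff ?gt_eqF// scale1r.
have m_le0 : m <= 0.
  rewrite md -[leRHS](scale0r e) vler_wpZ2r//.
  have : k + d <= k; last by rewrite gerDl.
  by apply: kmax; rewrite scalerDl addrC -vlerBrDr -md vleIl.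
have : g - k *: e - (h - c *: e) <= 0.
  apply: le_trans m_le0; rewrite vlexI vgerBl ?vsubr_ge0//=.
  by rewrite vlerBlDr addrCA subrr addr0 (le_trans (vgerBl _ _))// vscale_ge0.
rewrite vlerBlDr add0r vlerBlDr => /le_trans; apply.
rewrite -addrA vleD// scalerBl opprB addrC vleD2.
by rewrite vler_wpZ2r// ltW.
Qed.

Lemma atomic_order_compact_itv p q : dedekind_complete F -> atomic F ->
  p <= q -> order_compact `[p, q]%classic.
Proof.
move=> dcF atF pq U ultraU UI.
have clI : complete_lattice `[p, q]%classic by apply: dcF; exists p, q.
(* [A] and [B] collect the lower and upper bounds that [U] respects; the limit will be [s = t], the
   supremum of [A] and the infimum of [B]. *)
pose A := [set a | [/\ p <= a, a <= q & U `[a, q]%classic]].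
pose B := [set b | [/\ p <= b, b <= q & U `[p, b]%classic]].
have AI : A `<=` `[p, q]%classic.
  by move=> a [pa aq _]; rewrite /= in_itv /= pa aq.
have BI : B `<=` `[p, q]%classic.
  by move=> b [pb bq _]; rewrite /= in_itv /= pb bq.
have [[s [[sI sA] sle]] _] := clI A AI.
have [_ [t [[tI tB] tge]]] := clI B BI.
have AB a b : A a -> B b -> a <= b.
  move=> [_ _ Ua] [_ _ Ub]; have [x [/=]] := filter_ex (filterI Ua Ub).
  by rewrite !in_itv /= => /andP[ax _] /andP[_ +]; exact: le_trans.
have st : s <= t.
  apply: tge; split=> // b Bb; apply: sle; split; first exact: BI.
  by move=> a Aa; exact: AB.
move: (sI) (tI); rewrite /= !in_itv /= => /andP[ps sq] /andP[pt tq].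
have {}st : s = t.
  apply: contrapT => /eqP sNt.
  have ts0 : 0 < t - s by rewrite vsubr_gt0 lt_neqAle sNt.
  have [e /andP[_ ets] ate] := atF _ ts0; have e0 := ate.1.
  have sp0 : 0 <= s - p by rewrite vsubr_ge0.
  have qp0 : 0 <= q - p by rewrite vsubr_ge0.
  have [k [k0 kes kmax]] := maximal_coefficient e0 sp0.
  have [c [c0 ceh cmax]] := maximal_coefficient e0 qp0.
  have kc : k + 1 <= c.
    apply: cmax; rewrite scalerDl scale1r (le_trans (vleD kes ets))//.
    by rewrite addrC addrA subrK vleD2.
  (* Any [l] strictly between [k] and [k + 1] serves: [a] in [A] would force [l <= k], and [b] in
     [B] would force [k + 1 <= l]. *)
  pose l := k + 2^-1.
  have lc : 0 <= l <= c by rewrite /l; apply/andP; split; lra.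
  pose a := p + l *: e; pose b := q - (c - l) *: e.
  have ab x : p <= x <= q -> a <= x \/ x <= b.
    move=> /andP[px xq].
    have xI : 0 <= x - p <= q - p by rewrite vsubr_ge0 px vleD2.
    have [lx|xl] := atom_split ate xI ceh lc; [left|right].
      by rewrite /a addrC -vlerBrDr.
    by rewrite /b -(vleD2 (- p)) addrAC.
  have [Ua|UNa] := in_ultra_setVsetC `[a, q]%classic ultraU.
    have [x /=] := filter_ex Ua; rewrite in_itv /= => /andP[ax xq].
    have /sA/= : A a.
      split=> //; last exact: le_trans xq.
      by rewrite /a -{1}[p]addr0 vleD// vscale_ge0 ?(ltW e0)//; case/andP: lc.
    by rewrite /a addrC -vlerBrDr => /kmax; rewrite /l; lra.
  have Ub : U `[p, b]%classic.
    apply: filterS (filterI UNa UI) => x [] /=; rewrite !in_itv /= => xa xI.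
    case/andP: (xI) => px xq; rewrite px.
    by have [ax|//] := ab _ xI; case: xa; rewrite ax.
  have [x /=] := filter_ex Ub; rewrite in_itv /= => /andP[px xb].
  have /tB/= : B b.
    split=> //; first exact: le_trans xb.
    by rewrite /b vgerBl// vscale_ge0 ?(ltW e0)// subr_ge0; case/andP: lc.
  rewrite /b vlerBrDr => tlq.
  (* Here [q - p] is the sum of [q - t], [t - s] and [s - p], which dominate [c - l], [1] and [k]
     times [e]. *)
  have : (c - l + 1 + k) *: e <= q - p.
    rewrite !scalerDl scale1r -scalerDl vlerBrDr.
    apply: le_trans tlq; rewrite [t + _]addrC -!addrA vleD//.
    rewrite -[t](subrK s) vleD// -vlerBrDr.
    exact: kes.
  by move=> /cmax; rewrite /l; lra.
exists s => //.
(* Only intervals inside [[p, q]] are taken, so that their endpoints belong to [A] and [B]. *)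
exists [set K | exists a b,
  [/\ K = `[a, b]%classic, p <= a, a <= b, b <= q & U K]]; split.
- by move=> _ [a [b [-> _ ab _ _]]]; exists a, b.
- by move=> K [a [b []]].
apply/seteqP; split=> [x xJ|x ->].
  have xI : `[p, q]%classic x by apply: xJ; exists p, q.
  apply/le_anti/andP; split; last first.
    apply: sle; split=> // a [pa aq Ua].
    by have /= : `[a, q]%classic x; [apply: xJ; exists a, q|
      rewrite in_itv /= => /andP[]].
  rewrite st; apply: tge; split=> // b [pb bq Ub].
  by have /= : `[p, b]%classic x; [apply: xJ; exists p, b|
    rewrite in_itv /= => /andP[]].
move=> _ [a [b [-> pa ab bq Uab]]]; rewrite /= in_itv /=; apply/andP; split.
  apply: sA; split=> //; first exact: le_trans bq.
  by apply: filterS Uab => y /=; rewrite !in_itv /= => /andP[-> /le_trans->].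
rewrite st; apply: tB; split=> //; first exact: le_trans ab.
apply: filterS Uab => y /=; rewrite !in_itv /= => /andP[ay ->].
by rewrite (le_trans pa ay).
Qed.

(** * From local compactness to compact intervals *)

Lemma order_locally_compact_itv p q : order_locally_compact F -> p <= q ->
  order_compact `[p, q]%classic.
Proof.
move=> lcF pq; pose h := q - p; have h0 : 0 <= h by rewrite vsubr_ge0.
pose K n := `[0, n.+1%:R^-1 *: h]%classic : set F.
pose G := filter_from setT K.
have n0 n : 0 < n.+1%:R^-1 :> R by rewrite invr_gt0.
have K0 n : K n 0.
  by rewrite /K /= in_itv /= lexx vscale_ge0// ltW.
have Kmono m n : (m <= n)%N -> K n `<=` K m.
  move=> mn x; rewrite /K /= !in_itv /= => /andP[-> /le_trans]; apply.
  by rewrite vler_wpZ2r// lef_pV2 ?posrE// ler_nat.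
have GP : ProperFilter G.
  apply: filter_from_proper; last by move=> n _; exists 0.
  apply: filter_from_filter; first by exists 0%N.
  move=> m n _ _; exists (maxn m n) => // x Kx.
  by split; apply: Kmono Kx; [exact: leq_maxl|exact: leq_maxr].
have G0 : order_converges G 0.
  exists (range K); split.
  - by move=> _ [n _ <-]; exists 0, (n.+1%:R^-1 *: h); split;
      rewrite // vscale_ge0// ltW.
  - by move=> _ [n _ <-]; exists n.
  apply/seteqP; split=> [x xK|_ -> _ [n _ <-]//].
  have xKn n : 0 <= x <= n.+1%:R^-1 *: h.
    have : K n x by apply: xK; exists n.
    by rewrite /K /= in_itv.
  apply/le_anti/andP; split; last by case/andP: (xKn 0%N).
  apply: (archF (g := h)) => -[|n]//; case/andP: (xKn n) => _ xn.
  rewrite -scaler_nat -(vler_pZ2l _ _ (n0 n)) scalerA.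
  by rewrite mulVf ?pnatr_eq0// scale1r.
have [S [n _ KS] cptS] := lcF G GP (ex_intro _ 0 G0).
(* This affine order automorphism carries [[p, q]] onto [K n], which is compact as a subinterval of
   [S]. *)
have -> : `[p, q]%classic = (fun x => n.+1%:R^-1 *: (x - p)) @^-1` (K n).
  apply/seteqP; split=> x; rewrite /K /= !in_itv /= vler_pZ2l// vleD2;
    rewrite -{1}[0](scaler0 _ n.+1%:R^-1) vler_pZ2l// vsubr_ge0 //.
apply: (@order_compact_preimage _ _ _ (fun y => n.+1%:R *: y + p)).
- by move=> x; rewrite scalerA divff ?pnatr_eq0// scale1r subrK.
- by move=> x; rewrite addrK scalerA mulVf ?pnatr_eq0// scale1r.
- by move=> x y; rewrite vler_pZ2l// vleD2.
exact: order_compact_subitv KS.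
Qed.

(** * Disjoint splittings, and existence of atoms *)

(** Take [f] in [[0, p]] that is no multiple of [p] and remove its largest multiple of [p]. The
    remainder [f'] is not below some [g = p / n.+1], and not above it by maximality, so subtracting
    their meet from both leaves nonzero disjoint elements. *)
Lemma nonatom_split p : 0 < p -> ~ atom p ->
  exists u v, [/\ 0 < u <= p, 0 < v <= p & vmeet u v <= 0].
Proof.
move=> p0 Np; have p0' := ltW p0.
have [f [/andP[f0 fp] fNp]] :
    exists f, 0 <= f <= p /\ ~ exists c, f = c *: p.
  apply: contrapT => nf; apply: Np; split=> // f fp.
  by apply: contrapT => fNp; apply: nf; exists f.
have [c [c0 cpf cmax]] := maximal_coefficient p0 f0.
pose f' := f - c *: p.
have f'0 : 0 <= f' by rewrite vsubr_ge0.
have [n f'n] : exists n, ~~ (f' *+ n.+1 <= p).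
  apply: contrapT => nn; apply: fNp; exists c.
  apply/eqP; rewrite -subr_eq0; apply/eqP/le_anti.
  rewrite f'0 andbT; apply: (archF (g := p)) => -[|n]//.
  by apply: contrapT => /negP f'n; apply: nn; exists n.
have n0 : 0 < n.+1%:R^-1 :> R by rewrite invr_gt0.
pose g := n.+1%:R^-1 *: p; pose m := vmeet f' g.
have g0 : 0 <= g by rewrite vscale_ge0// ltW.
have m0 : 0 <= m by rewrite vlexI f'0.
exists (f' - m), (g - m); split; last exact: vmeet_subI_le0.
- rewrite vsubr_gt0 lt_neqAle vleIl andbT; apply/andP; split.
    apply: contra f'n => /eqP mf'; have : m <= g by exact: vleIr.
    rewrite mf' -(vler_pZ2l (c := n.+1%:R))// scaler_nat.
    by rewrite scalerA divff ?pnatr_eq0// scale1r.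
  rewrite (le_trans (vgerBl _ m0))// (le_trans _ fp)//.
  by rewrite vgerBl// vscale_ge0.
rewrite vsubr_gt0 lt_neqAle vleIr andbT; apply/andP; split.
  apply/eqP => mg; have : m <= f' by exact: vleIl.
  rewrite mg /f' vlerBrDr -scalerDl => /cmax.
  by rewrite gerDr leNgt n0.
rewrite (le_trans (vgerBl _ m0))// -[leRHS]scale1r vler_wpZ2r//.
by rewrite invf_le1// ler1n.
Qed.

(* When [p n] meets some earlier [q i], the two share a splitting of the
   meet. *)
Lemma disjoint_refinement g (p : nat -> F) n :
  (forall x, 0 < x <= g -> ~ atom x) ->
  (forall k, (k < n)%N -> 0 < p k <= g) ->
  exists q : nat -> F, (forall k, (k < n)%N -> 0 < q k <= p k) /\
    (forall j k, (j < n)%N -> (k < n)%N -> j != k -> vmeet (q j) (q k) <= 0).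
Proof.
move=> gNa; elim: n => [|n IHn] pg; first by exists p.
have [k kn|q [qp qdisj]] := IHn; first by apply: pg; exact: ltnW.
have /andP[pn0 png] := pg n (leqnn _).
(* Shrinking the old elements keeps them disjoint, so only their positivity and their disjointness
   from the new [v] need checking. *)
have extend (r : nat -> F) (v : F) : 0 < v <= p n ->
    (forall k, (k < n)%N -> 0 < r k <= q k /\ vmeet (r k) v <= 0) ->
  exists q : nat -> F, (forall k, (k < n.+1)%N -> 0 < q k <= p k) /\
    (forall j k, (j < n.+1)%N -> (k < n.+1)%N -> j != k ->
      vmeet (q j) (q k) <= 0).
  move=> vp rP; exists (fun k => if k == n then v else r k); split.
    move=> k; rewrite ltnS leq_eqVlt; case: eqVneq => [->//|_ /= kn].
    have [/andP[-> rq] _] := rP _ kn; have /andP[_ qpk] := qp _ kn.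
    exact: le_trans qpk.
  move=> j k; rewrite !ltnS [(j <= n)%N]leq_eqVlt [(k <= n)%N]leq_eqVlt.
  case: (eqVneq j n) => [->|_] /=; case: (eqVneq k n) => [->|_] //=.
  - by move=> _ kn _; rewrite vmeetC; case: (rP _ kn).
  - by move=> jn _ _; case: (rP _ jn).
  move=> jn kn jk; have [/andP[_ rqj] _] := rP _ jn.
  have [/andP[_ rqk] _] := rP _ kn.
  exact: vmeet_le0S rqj rqk (qdisj _ _ jn kn jk).
have [[i iin pqi]|npq] :=
    pselect (exists2 i, (i < n)%N & ~~ (vmeet (p n) (q i) <= 0)); last first.
  apply: (extend q (p n)); first by rewrite pn0 lexx.
  move=> k kn; have /andP[-> _] := qp _ kn; rewrite lexx; split=> //.
  by apply: contrapT => /negP pqk; apply: npq; exists k => //; rewrite vmeetC.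
have /andP[qi0 qpi] := qp _ iin.
set m := vmeet (p n) (q i) in pqi.
have m0 : 0 < m.
  rewrite lt_neqAle vlexI (ltW pn0) (ltW qi0) !andbT.
  by apply: contra pqi => /eqP<-.
have mg : 0 < m <= g by rewrite m0 (le_trans (vleIl _ _) png).
have [u [v [/andP[u0 um] /andP[v0 vm] uv]]] := nonatom_split m0 (gNa _ mg).
(* Being below [q i], [v] is disjoint from every other [q k]; replacing [q i] by [u] settles the
   index [i]. *)
have vq : v <= q i by rewrite (le_trans vm)// vleIr.
apply: (extend (fun k => if k == i then u else q k) v).
  by rewrite v0 (le_trans vm)// vleIl.
move=> k kn; case: eqVneq => [->|ki].
  by rewrite u0 (le_trans um)// vleIr.
have /andP[-> _] := qp _ kn; rewrite lexx; split=> //.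
exact: vmeet_le0S (lexx _) vq (qdisj _ _ kn iin ki).
Qed.

Lemma exists_splitting g (L : seq F) : 0 < g ->
  (forall x, 0 < x <= g -> ~ atom x) ->
  (forall p, p \in L -> 0 < p <= g) ->
  exists2 x, 0 <= x <= g & forall p, p \in L -> ~~ (p <= x) /\ ~~ (p <= g - x).
Proof.
move=> g0 gNa Lg; set n := size L.
(* Halving the index lists each element of [L] twice; even positions give the [r i] and odd ones the
   [s i]. *)
have [|q [qL qdisj]] := @disjoint_refinement g (fun k => nth g L k./2) n.*2 gNa.
  by move=> k kn; apply/Lg/mem_nth; rewrite ltn_half_double.
have ltr i : (i < n)%N -> (i.*2 < n.*2)%N by rewrite ltn_double.
have lts i : (i < n)%N -> (i.*2.+1 < n.*2)%N by rewrite ltn_Sdouble.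
pose r i := q i.*2; pose s i := q i.*2.+1.
have rL i : (i < n)%N -> 0 < r i <= nth g L i.
  by move=> /ltr/qL; rewrite doubleK.
have sL i : (i < n)%N -> 0 < s i <= nth g L i.
  by move=> /lts/qL; rewrite /= uphalf_double.
have s_ge0 i : (i < n)%N -> 0 <= s i by move=> /sL/andP[/ltW].
pose t := \sum_(i < n) s i.
have t0 : 0 <= t by exact: vsumr_ge0.
have rt i N : (i < n)%N -> vmeet (r i) (t *+ N) <= 0.
  move=> iin; apply: vmeet_le0_mulrn => //; apply: vmeet_le0_sum => j jn.
  split; first exact: s_ge0.
  apply: qdisj; [exact: ltr|exact: lts|].
  by apply/eqP => /(congr1 odd); rewrite /= !odd_double.
(* Otherwise induction gives [s i *+ N <= g] for all [N]: the bound at [N] puts [s i *+ N] below the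
   meet, and adding [s i] stays below [g]. *)
have sN (i : 'I_n) : exists N, ~~ (s i <= g - vmeet (t *+ N) g).
  apply: contrapT => nN; have /andP[si0 _] := sL i (ltn_ord i).
  have sN N : s i <= g - vmeet (t *+ N) g.
    by apply: contrapT => /negP sN; apply: nN; exists N.
  suff : s i <= 0 by rewrite lt_geF.
  apply: (archF (g := g)); elim=> [|N IHN]; first exact: ltW.
  rewrite mulrSr addrC -vlerBrDr.
  have : s i *+ N <= vmeet (t *+ N) g.
    rewrite vlexI IHN andbT -!scaler_nat vler_wpZ2l//.
    exact: vler_sum (ltn_ord i) s_ge0.
  move=> /(vleD (sN N)); rewrite subrK => sNg.
  by rewrite vlerBrDr.
have [Nf NfP] := choice sN.
(* The maximum serves all [i] at once, since [g - vmeet (t *+ N) g] decreases as [N] grows. *)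
pose N := \max_(i < n) Nf i; exists (vmeet (t *+ N) g).
  rewrite vleIr vlexI (ltW g0) andbT andbT.
  by rewrite -scaler_nat vscale_ge0.
move=> p pL; have iin : (index p L < n)%N by rewrite index_mem.
have pE : nth g L (index p L) = p by rewrite nth_index.
have /andP[r0 rp] := rL _ iin; have /andP[_ sp] := sL _ iin.
rewrite pE in rp sp; split; apply/negP => px.
  suff : r (index p L) <= 0 by rewrite lt_geF.
  apply: le_trans (rt _ N iin); rewrite vlexI lexx /=.
  by rewrite (le_trans rp)// (le_trans px)// vleIl.
have /negP := NfP (Ordinal iin); apply; rewrite (le_trans sp)// (le_trans px)//.
rewrite vlerBlDr addrAC vlerBrDr vleD//.
rewrite vlexI vleIr andbT (le_trans (vleIl _ _))//.
rewrite -!scaler_nat vler_wpZ2r// ler_nat.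
exact: (leq_bigmax (Ordinal iin)).
Qed.

Lemma order_compact_itv_atom g : 0 < g -> order_compact `[0, g]%classic ->
  exists2 f, 0 <= f <= g & atom f.
Proof.
move=> g0 cptI; apply: contrapT => nat.
have gNa x : 0 < x <= g -> ~ atom x.
  by move=> /andP[x0 xg] ax; apply: nat; exists x; rewrite // (ltW x0).
pose D := [set L : seq F | forall p, p \in L -> 0 < p <= g].
pose X (L : seq F) := [set x | 0 <= x <= g /\
  forall p, p \in L -> ~~ (p <= x) /\ ~~ (p <= g - x)].
have GP : ProperFilter (filter_from D X).
  apply: filter_from_proper; last first.
    by move=> L DL; have [x xg xL] := exists_splitting g0 gNa DL; exists x.
  apply: filter_from_filter; first by exists [::].
  move=> L M DL DM; exists (L ++ M).
    by move=> p; rewrite mem_cat => /orP[/DL|/DM].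
  move=> x [xg xLM].
  by split; split=> // p pL; apply: xLM; rewrite mem_cat pL ?orbT.
have [U [ultraU GU]] := ultraFilterLemma GP.
have UI : U `[0, g]%classic.
  by apply: GU; exists [::] => // x [+ _]; rewrite /= in_itv.
have [x _ [J [Jitv JU Jx]]] := cptI U ultraU UI.
have UX p : 0 < p <= g -> U (X [:: p]).
  by move=> pg; apply: GU; exists [:: p] => // y; rewrite inE => /eqP->.
(* If [a <= 0] fails, [p = vjoin a 0] lies below every point of [K] in [[0, g]], against [X [:: p]]
   in [U]. If [g <= b] fails, [p = g - vmeet b g] lies below [g - z] for every such point [z]. *)
have JE K : J K -> exists a b, [/\ K = `[a, b]%classic, a <= 0 & g <= b].
  move=> JK; have [a [b [_ KE]]] := Jitv _ JK; exists a, b.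
  have UK : U `[a, b]%classic by rewrite -KE; exact: JU.
  have [y [/=]] := filter_ex (filterI UK UI).
  rewrite !in_itv /= => /andP[ay yb] /andP[y0 yg].
  split=> //; apply: contrapT => /negP.
    move=> aN0; pose p := vjoin a 0.
    have pg : 0 < p <= g.
      rewrite lt_neqAle vleUr andbT vleUx (le_trans ay yg) (ltW g0) !andbT.
      by apply: contra aN0 => /eqP->; exact: vleUl.
    have [z [/= zab [zg zp]]] := filter_ex (filterI UK (UX _ pg)).
    have [/negP pNz _] := zp p (mem_head _ _); apply: pNz; rewrite vleUx.
    by case/andP: zg => -> _; move: zab; rewrite in_itv /= => /andP[->].
  move=> gNb; pose p := g - vmeet b g.
  have b0 : 0 <= vmeet b g by rewrite vlexI (ltW g0) (le_trans y0 yb).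
  have pg : 0 < p <= g.
    rewrite vsubr_gt0 lt_neqAle vleIr vgerBl// !andbT.
    by apply: contra gNb => /eqP<-; exact: vleIl.
  have [z [/= zab [zg zp]]] := filter_ex (filterI UK (UX _ pg)).
  have [_ /negP] := zp p (mem_head _ _); apply.
  rewrite vlerBlDr addrAC vlerBrDr vleD// vlexI.
  by case/andP: zg => _ ->; move: zab; rewrite in_itv /= => /andP[_ ->].
(* The whole of [[0, g]] lies in the intersection, which is a singleton; this collapses [0] and
   [g]. *)
have xE z : 0 <= z <= g -> z = x.
  move=> /andP[z0 zg]; suff : (\bigcap_(K in J) K) z by rewrite Jx.
  move=> _ /JE[a [b [-> a0 gb]]]; rewrite /= in_itv /=.
  by rewrite (le_trans a0 z0) (le_trans zg gb).
have gx : g = x by apply: xE; rewrite lexx ltW.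
have x0 : 0 = x by apply: xE; rewrite lexx ltW.
by move: g0; rewrite gx -x0 ltxx.
Qed.

End VectorLatticeTheory.

Theorem theorem4p9 (R : realType) (F : vectorLatticeType R)
    (hF : archimedean F) :
  [<-> (* (i) *) dedekind_complete F /\ atomic F;
       (* (ii) *) forall I : set F, order_interval I -> order_compact I;
       (* (iii) *) order_locally_compact F].
Proof.
tfae.
- move=> [dcF atF] _ [p [q [pq ->]]].
  exact: atomic_order_compact_itv.
- move=> cptI U UP [p [J [Jitv JU Jp]]].
  have [[K JK]|J0] := pselect (J !=set0).
    by exists K; [exact: JU|exact/cptI/Jitv].
  exists `[p, p]%classic; last by apply: cptI; exists p, p.
  (* The empty intersection is [setT], so [F] is a singleton. *)
  suff -> : `[p, p]%classic = setT by exact: filterT.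
  apply/seteqP; split=> // x _.
  have -> : x = p.
    have : (\bigcap_(I in J) I) x by move=> K JK; case: J0; exists K.
    by rewrite Jp.
  by rewrite /= in_itv /= lexx.
move=> lcF; split.
  move=> _ [p [q [pq ->]]]; apply: order_compact_itv_complete_lattice => //.
  exact: order_locally_compact_itv.
move=> g g0; apply: order_compact_itv_atom => //.
exact: order_locally_compact_itv (ltW g0).
Qed.
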